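(* Suppose that $\mathbb{E}(\bm X_2^*\mid \bm X_1^* )=0$. Then $S_0\subseteq S_{\lambda_0}\cup S_{C_0}$. If, in addition, the censoring time $C$ is independent of $\bm X$, then $S_0\subseteq S_{\lambda_0}$.
   Context: Let $T$ be a failure time with true conditional hazard function $\lambda_0(t\mid \bm X)$ given a covariate vector $\bm X=(X_1,\dots,X_p)^T$, let $C$ be a censoring time, $Y=\min(T,C)$ and $\Delta=1(T\le C)$. A possibly misspecified Cox working model $\lambda(t\mid \bm X)=\lambda(t)\exp(\bm X^T\beta)$ is fitted. For $r=0,1,2$ let $\mu_r(t;\beta)=\mathbb{E}\{1(Y\ge t)\bm X^{\otimes r}\exp(\bm X^T\beta)\}$ and $\mu_r(t)=\mathbb{E}\{1(Y\ge t)\bm X^{\otimes r}\lambda_0(t\mid \bm X)\}$, where $\bm X^{\otimes 0}=1$, $\bm X^{\otimes 1}=\bm X$, $\bm X^{\otimes 2}=\bm X\bm X^T$. The pseudo-true parameter $\beta_0$ is the unique solution of the $p$ equations $\int_0^\infty \mu_1(t)\,dt-\int_0^\infty \frac{\mu_1(t;\beta)}{\mu_0(t;\beta)}\mu_0(t)\,dt=0$, assuming $\Sigma_{\beta_0}=\int_0^\infty\{\mu_2(t;\beta_0)/\mu_0(t;\beta_0)-[\mu_1(t;\beta_0)/\mu_0(t;\beta_0)]^{\otimes 2}\}\mu_0(t)\,dt$ is positive definite. Define $S_0=\{j:\beta_{0j}\ne 0\}$, $S_{\lambda_0}$ the index set of all covariates having an influence on the true conditional hazard $\lambda_0(t\mid\cdot)$,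 and $S_{C_0}$ the index set of all covariates having an influence on the conditional distribution of $C$ given $\bm X$. Let $\bm X_1^*$ be the sub-vector of $\bm X$ indexed by $S_{\lambda_0}\cup S_{C_0}$ and $\bm X_2^*$ the sub-vector indexed by its complement.
   Formalization: The formal theorem assumes the failure time T and the censoring time C are conditionally independent given X (without this the claim can fail), and that the expectations and integrals defining the estimating equations, and the log-likelihood integral, are finite for every β. *)

(* Defs.v *)
From HB Require Import structures.
From mathcomp Require Import all_boot all_order all_algebra.
From mathcomp Require Import all_classical all_reals all_analysis.
Set Implicit Arguments. Unset Strict Implicit. Unset Printing Implicit Defensive.
Import Order.TTheory GRing.Theory Num.Theory.
Import numFieldNormedType.Exports.
Local Open Scope classical_set_scope.
Local Open Scope ring_scope.

Section CoxDefs.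
Context {R : realType} {p : nat} {d : measure_display} {Omega : measurableType d}.

Definition leb := (@lebesgue_measure R).

Definition Rint0oo (f : R -> R) : R := Rintegral leb [set t : R | 0 <= t] f.

Definition Xc (X : Omega -> p.-tuple R) (j : 'I_p) (w : Omega) : R := tnth (X w) j.

Definition sigmaX (X : Omega -> p.-tuple R) (S : set 'I_p) : set (set Omega) :=
  <<s \bigcup_(i in S) preimage_set_system setT (Xc X i) measurable >>.

(** E(Z | F) = 0 a.s. : Z integrable and E[Z 1_A] = 0 for every A in F
    (the defining property of the conditional expectation). *)
Definition condexp_zero (P : probability Omega R) (Z : Omega -> R)
    (F : set (set Omega)) : Prop :=
  P.-integrable setT (fun w => (Z w)%:E) /\
  forall A, F A -> (\int[P]_(w in A) (Z w)%:E = 0)%E.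

Definition influences (f : R -> p.-tuple R -> R) (j : 'I_p) : Prop :=
  exists (t : R) (x y : p.-tuple R),
    (forall k, k != j -> tnth x k = tnth y k) /\ f t x != f t y.

Definition Sinfl (f : R -> p.-tuple R -> R) : set 'I_p := [set j | influences f j].

(** Conditional survival function of T given X = x, from the hazard lam0:
    exp(- int_0^t lam0(s|x) ds)  (value in [0,1], extended reals). *)
Definition survT (lam0 : R -> p.-tuple R -> R) (t : R) (x : p.-tuple R) : \bar R :=
  expeR (- (\int[leb]_(s in [set s : R | (0 <= s <= t)%R]) (lam0 s x)%:E))%E.

Definition atrisk (T C : Omega -> R) (t : R) (w : Omega) : R :=
  if t <= Num.min (T w) (C w) then 1 else 0.

Definition lin (X : Omega -> p.-tuple R) (b : 'rV[R]_p) (w : Omega) : R :=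
  \sum_(j < p) Xc X j w * b 0 j.

Definition mu0b P X T C b t : R :=
  Rintegral P setT (fun w => atrisk T C t w * expR (lin X b w)).
Definition mu1b P X T C b t (j : 'I_p) : R :=
  Rintegral P setT (fun w => atrisk T C t w * Xc X j w * expR (lin X b w)).
Definition mu2b P X T C b t (j k : 'I_p) : R :=
  Rintegral P setT (fun w => atrisk T C t w * (Xc X j w * Xc X k w) * expR (lin X b w)).
Definition mu0 P X T C (lam0 : R -> p.-tuple R -> R) t : R :=
  Rintegral P setT (fun w => atrisk T C t w * lam0 t (X w)).
Definition mu1 P X T C (lam0 : R -> p.-tuple R -> R) t (j : 'I_p) : R :=
  Rintegral P setT (fun w => atrisk T C t w * Xc X j w * lam0 t (X w)).

(** j-th component of the population estimating function of the Cox working model. *)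
Definition estim P X T C lam0 b (j : 'I_p) : R :=
  Rint0oo (fun t => mu1 P X T C lam0 t j)
  - Rint0oo (fun t => mu1b P X T C b t j / mu0b P X T C b t * mu0 P X T C lam0 t).

Definition Sigma P X T C lam0 b : 'M[R]_p :=
  \matrix_(j, k) Rint0oo (fun t =>
     (mu2b P X T C b t j k / mu0b P X T C b t
      - (mu1b P X T C b t j / mu0b P X T C b t) * (mu1b P X T C b t k / mu0b P X T C b t))
     * mu0 P X T C lam0 t).

Definition posdef (M : 'M[R]_p) : Prop :=
  forall v : 'rV[R]_p, v != 0 -> 0 < (v *m M *m v^T) 0 0.

End CoxDefs.

(* Main.v *)
(** The estimating function is the gradient of the concave log partial
    likelihood l(b) = sum_j b_j int mu1_j(t) dt - int ln mu0(t; b) mu0(t) dt.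
    Let b be b0 with its coordinates outside S (= S_lambda0 U S_C0) set to 0.
    The conditional survival probability P(Y >= t | X) depends on X only through
    X1star, so E(X2star | X1star) = 0 gives mu1_j(t) = mu1_j(t; b) = 0 for j
    outside S, and the conditional Jensen inequality gives
    mu0(t; b) <= mu0(t; b0).  Hence l(b) >= l(b0).  On the other hand, Jensen's
    inequality under the law of X tilted by 1(Y >= t) exp(X b0) gives
    l(b) <= l(b0), because b0 solves the estimating equations.  In the equality
    case X (b - b0) is almost surely constant on {Y >= t} for almost every
    relevant t, so b and b0 have the same ratios mu1(t; .) / mu0(t; .) there; b
    then solves the estimating equations too, and b = b0 by uniqueness. *)
Require Import Defs.
From HB Require Import structures.
From mathcomp Require Import all_boot all_order all_algebra.
From mathcomp Require Import all_classical all_reals all_analysis.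
From mathcomp Require Import measurable_realfun.
From mathcomp Require Import ring lra.
Import Order.TTheory GRing.Theory Num.Theory.
Import numFieldNormedType.Exports.
Local Open Scope classical_set_scope.
Local Open Scope ring_scope.

(** * Integrals of a function of a random element against two weights *)

Section integral_comp.
Import HBNNSimple.

(** For a simple [phi] this is a finite combination of the hypothesis on preimages; monotone
    convergence then gives the general case. Keeping everything nonnegative makes the identity
    meaningful even when both sides are infinite. *)
Lemma integral_comp_eq (d d' : measure_display) (T : measurableType d)
    (E : measurableType d') (R : realType) (mu : {measure set T -> \bar R})
    (Z : T -> E) (u v : T -> R) (phi : E -> \bar R) :
  measurable_fun setT Z -> measurable_fun setT u -> measurable_fun setT v ->
  (forall x, 0 <= u x) -> (forall x, 0 <= v x) ->
  (forall B, measurable B -> (\int[mu]_(x in Z @^-1` B) (u x)%:E =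
                              \int[mu]_(x in Z @^-1` B) (v x)%:E)%E) ->
  measurable_fun setT phi -> (forall z, (0 <= phi z)%E) ->
  (\int[mu]_x (phi (Z x) * (u x)%:E) = \int[mu]_x (phi (Z x) * (v x)%:E))%E.
Proof.
move=> mZ mu_ mv u0 v0 uv mphi phi0.
pose g := nnsfun_approx measurableT mphi.
have mgZ n : measurable_fun setT (fun x => g n (Z x)) by exact: measurableT_comp.
have sfunE n (w : T -> R) : measurable_fun setT w -> (forall x, 0 <= w x) ->
    (\int[mu]_x ((g n (Z x))%:E * (w x)%:E) =
     \sum_(y \in range (g n))
       (y%:E * \int[mu]_(x in Z @^-1` (g n @^-1` [set y])) (w x)%:E))%E.
  move=> mw w0.
  under eq_integral => x _.
    rewrite (fimfunE (g n)) -fsumEFin// ge0_mule_fsuml; last first.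
      by move=> r; rewrite EFinM nnfun_muleindic_ge0.
    over.
  have mterm r : measurable_fun setT
      (fun x => (r * \1_(g n @^-1` [set r]) (Z x))%:E * (w x)%:E)%E.
    apply: emeasurable_funM; last exact/measurable_EFinP.
    apply/measurable_EFinP/measurable_funM => //.
    by apply: (measurableT_comp _ mZ); exact: measurable_indic.
  rewrite ge0_integral_fsum//; last first.
    by move=> r x _; rewrite mule_ge0 ?lee_fin// -lee_fin EFinM nnfun_muleindic_ge0.
  apply: eq_fsbigr => r; rewrite inE => -[/= t _ <-{r}].
  have mp : measurable (Z @^-1` (g n @^-1` [set g n t])).
    by rewrite -[X in measurable X]setTI; apply: mZ.
  under eq_integral do rewrite EFinM -muleA.
  rewrite ge0_integralZl//.
  - congr (_ * _)%E; rewrite [RHS]integral_mkcond.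
    by apply: eq_integral => x _; rewrite epatch_indic muleC.
  - apply: emeasurable_funM; last exact/measurable_EFinP.
    apply/measurable_EFinP.
    by apply: (measurableT_comp _ mZ); exact: measurable_indic.
  - by move=> x _; rewrite mule_ge0// lee_fin.
  - by rewrite lee_fin; exact: fun_ge0.
(* The approximants [g n] increase to [phi], and multiplying by [w >= 0] preserves this. *)
have limE (w : T -> R) : measurable_fun setT w -> (forall x, 0 <= w x) ->
    (\int[mu]_x (phi (Z x) * (w x)%:E) =
     limn (fun n => \int[mu]_x ((g n (Z x))%:E * (w x)%:E)))%E.
  move=> mw w0; rewrite -monotone_convergence//.
  - apply: eq_integral => x _; apply/esym/cvg_lim => //.
    by apply: cvgeZr => //; exact: cvg_nnsfun_approx.
  - by move=> n; apply: emeasurable_funM; exact/measurable_EFinP.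
  - by move=> n x _; rewrite mule_ge0// lee_fin.
  - move=> x _ m n mn; rewrite lee_wpmul2r ?lee_fin//.
    exact/lefP/nd_nnsfun_approx.
rewrite !limE//; congr (limn _); apply/funext => n; rewrite !sfunE//.
apply: eq_fsbigr => y _; congr (_ * _)%E; apply: uv.
by rewrite -[X in measurable X]setTI; exact: measurable_funPT.
Qed.

End integral_comp.

(** * Functions of a subset of the coordinates *)

(** Measurability into tuples is coordinatewise, and each coordinate of [Z] is either one of the
    generators of [sigmaX X S] or constant. *)
Lemma sigmaX_preimage (R : realType) (p : nat) (d : measure_display)
    (Omega : measurableType d) (X : Omega -> p.-tuple R) (S : set 'I_p)
    (Z : Omega -> p.-tuple R) :
  (forall i, (S i /\ forall w, tnth (Z w) i = Xc X i w) \/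
             exists c, forall w, tnth (Z w) i = c) ->
  forall B, measurable B -> sigmaX X S (Z @^-1` B).
Proof.
move=> ZX B mB.
pose G := \bigcup_(i in S) preimage_set_system setT (Xc X i) measurable.
have mZ : measurable_fun setT (Z : g_sigma_algebraType G -> p.-tuple R).
  apply/measurable_fun_tnthP => i.
  have [[Si Zi]|[c Zi]] := ZX i.
    move=> _ A mA; apply: sub_sigma_algebra; exists i => //; exists A => //.
    by congr (_ `&` _); apply/seteqP; split=> w /=; rewrite Zi.
  rewrite (_ : _ \o _ = cst c)//; exact/funext.
by have := mZ measurableT _ mB; rewrite setTI.
Qed.

(* Coordinates outside [S] are set to [0], so that [keep S] of [X] generates the
   same sigma-algebra as the sub-vector of [X] indexed by [S]. *)
Definition keep {R : realType} {p : nat} (S : set 'I_p) (x : p.-tuple R) :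
    p.-tuple R := [tuple if `[< S i >] then tnth x i else 0 | i < p].

Lemma tnth_keep (R : realType) (p : nat) (S : set 'I_p) (x : p.-tuple R) i :
  tnth (keep S x) i = if `[< S i >] then tnth x i else 0.
Proof. by rewrite tnth_mktuple. Qed.

(** Influence is defined by varying a single coordinate, so [x] is turned into [y] one coordinate at
    a time. *)
Lemma Sinfl_eq (R : realType) (p : nat) (f : R -> p.-tuple R -> R)
    (S : set 'I_p) t (x y : p.-tuple R) :
  Sinfl f `<=` S -> (forall i, S i -> tnth x i = tnth y i) -> f t x = f t y.
Proof.
move=> fS xy.
(* Hybrid point: the first [k] coordinates come from [y], the others from [x]. *)
pose h k : p.-tuple R := [tuple if (i < k)%N then tnth y i else tnth x i | i < p].
have -> : y = h p.
  by apply: eq_from_tnth => i; rewrite tnth_mktuple ltn_ord.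
have : (p <= p)%N by [].
(* The induction is on the index of [h] and its bound; the dimension stays [p]. *)
elim: {1 3}p => [_|k ih kp].
  by congr (f t _); apply: eq_from_tnth => i; rewrite tnth_mktuple.
rewrite (ih (ltnW kp)).
pose ik := Ordinal kp.
have [Sk|Sk] := pselect (S ik).
  congr (f t _); apply: eq_from_tnth => i; rewrite !tnth_mktuple.
  rewrite [(i < k.+1)%N]ltnS [(i <= k)%N]leq_eqVlt.
  case: eqVneq => //= e; rewrite e ltnn; have -> : i = ik by apply/val_inj.
  exact: xy.
(* Different values at [h k] and [h k.+1] would make coordinate [k] influential, hence a member of
   [S]. *)
apply: contrapT => /eqP ne; apply: Sk; apply: fS; exists t, (h k), (h k.+1).
split=> // i ik'; rewrite !tnth_mktuple.
  rewrite [(i < k.+1)%N]ltnS [(i <= k)%N]leq_eqVlt.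
by have -> : (i == k :> nat) = false by apply/negbTE.
Qed.

(** * Survival functions and conditioning on the covariates *)

Lemma measurable_survT (R : realType) (p : nat) (lam0 : R -> p.-tuple R -> R) t :
  (forall s x, 0 <= lam0 s x) ->
  measurable_fun setT (fun z : R * p.-tuple R => lam0 z.1 z.2) ->
  measurable_fun setT (fun x => fine (survT lam0 t x)).
Proof.
move=> l0 ml.
pose I (x : p.-tuple R) := (\int[leb]_(s in [set s : R | (0 <= s <= t)%R]) (lam0 s x)%:E)%E.
have mI : measurable_fun setT I.
  (* The indicator turns the integral over [[0, t]] into a full section integral, to which Tonelli's
     measurability result applies. *)
  pose f (z : p.-tuple R * R) := ((lam0 z.2 z.1 * \1_`[0, t] z.2)%:E)%E.
  have mf : measurable_fun setT f.
    apply/measurable_EFinP/measurable_funM.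
      exact: (measurableT_comp ml (measurable_swap (T1 := p.-tuple R) (T2 := R))).
    by apply: (measurableT_comp _ measurable_snd); exact: measurable_indic.
  have f0 z : (0 <= f z)%E by rewrite lee_fin mulr_ge0.
  have := measurable_fun_fubini_tonelli_F (m2 := @lebesgue_measure R) f mf f0.
  congr (measurable_fun _ _); apply/funext => x.
  rewrite /I /fubini_F [RHS]integral_mkcond; apply: eq_integral => s _.
  rewrite epatch_indic/= /f EFinM (_ : [set` `[0, t]] = [set s : R | 0 <= s <= t]); last first.
    by apply/seteqP; split => y /=; rewrite in_itv.
  by [].
have I0 x : (0 <= I x)%E by apply: integral_ge0 => s _; rewrite lee_fin.
(* An infinite cumulative hazard needs its own case: survival is then 0, whereas [fine] sends [+oo]
   to 0 and the exponential would be 1. *)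
have -> : (fun x => fine (survT lam0 t x)) =
    (fun x => if (I x == +oo)%E then 0 else expR (- fine (I x))).
  apply/funext => x; rewrite /survT -/(I x).
  by case: (I x) (I0 x) => //=.
apply: measurable_fun_ifT => //.
  apply: (measurable_fun_bool true); rewrite setTI.
  rewrite (_ : _ @^-1` _ = setT `&` I @^-1` [set +oo%E]); first exact: mI.
  by rewrite setTI; apply/seteqP; split => x /= /eqP.
apply: measurableT_comp => //; apply: measurable_funN.
exact: measurableT_comp.
Qed.

Lemma measurable_atrisk (d : measure_display) (Omega : measurableType d)
    (R : realType) (T C : Omega -> R) t :
  measurable_fun setT T -> measurable_fun setT C ->
  measurable_fun setT (atrisk T C t).
Proof.
move=> mT mC; apply: measurable_fun_ifT => //.
by apply: measurable_fun_ler => //; exact: measurable_minr.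
Qed.

Lemma atrisk_ge0 (d : measure_display) (Omega : measurableType d)
    (R : realType) (T C : Omega -> R) t w : 0 <= atrisk T C t w.
Proof. by rewrite /atrisk; case: ifP. Qed.

Lemma survT_fin_num (R : realType) (p : nat) (lam0 : R -> p.-tuple R -> R) t x :
  (forall s y, 0 <= lam0 s y) -> survT lam0 t x \is a fin_num.
Proof.
move=> l0; rewrite /survT.
have : (0 <= \int[leb]_(s in [set s : R | (0 <= s <= t)%R]) (lam0 s x)%:E)%E.
  by apply: integral_ge0 => s _; rewrite lee_fin.
by case: (integral _ _ _).
Qed.

(** Replaces 1(Y >= t) by its conditional probability given [X]. The sign of [G] is not prescribed
    pointwise, so the product is truncated at 0 to obtain a nonnegative weight; the truncation
    changes it only where {Y >= t} has probability zero. *)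
Lemma integral_atrisk (R : realType) (p : nat) (d : measure_display)
    (Omega : measurableType d) (P : probability Omega R)
    (X : Omega -> p.-tuple R) (T C : Omega -> R)
    (lam0 : R -> p.-tuple R -> R) (G : R -> p.-tuple R -> R) t
    (phi : p.-tuple R -> \bar R) :
  measurable_fun setT X -> measurable_fun setT T -> measurable_fun setT C ->
  (forall s x, 0 <= lam0 s x) ->
  measurable_fun setT (fun z : R * p.-tuple R => lam0 z.1 z.2) ->
  measurable_fun setT (G t) ->
  (forall A : set Omega, sigmaX X setT A ->
     P (A `&` [set w | t <= T w] `&` [set w | t <= C w]) =
     (\int[P]_(w in A) (survT lam0 t (X w) * (G t (X w))%:E))%E) ->
  measurable_fun setT phi -> (forall x, (0 <= phi x)%E) ->
  (\int[P]_w (phi (X w) * (atrisk T C t w)%:E) =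
   \int[P]_w (phi (X w) *
     (Num.max 0 (fine (survT lam0 t (X w)) * G t (X w)))%:E))%E.
Proof.
move=> mX mT mC l0 ml mG law mphi phi0.
pose h x := fine (survT lam0 t x) * G t x.
have mh : measurable_fun setT h by apply: measurable_funM => //; exact: measurable_survT.
have mXB B : measurable B -> measurable (X @^-1` B).
  by move=> mB; rewrite -[X in measurable X]setTI; exact: mX.
pose Y := [set w | t <= T w] `&` [set w | t <= C w].
have mY : measurable Y.
  rewrite /Y -[X in measurable (X `&` _)]setTI -[X in measurable (_ `&` X)]setTI.
  by apply: measurableI; apply: measurable_fun_le.
have lawh B : measurable B ->
    (P (X @^-1` B `&` Y) = \int[P]_(w in X @^-1` B) (h (X w))%:E)%E.
  move=> mB; rewrite setIA law; last first.
    by apply: sigmaX_preimage => // i; left.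
  by apply: eq_integral => w _; rewrite EFinM fineK// survT_fin_num.
apply: integral_comp_eq => //.
- exact: measurable_atrisk.
- apply: measurable_maxr => //; exact: (measurableT_comp mh mX).
- by move=> w; exact: atrisk_ge0.
- by move=> w; rewrite le_max lexx.
move=> B mB.
pose N := [set x | h x < 0].
have mN : measurable N.
  rewrite (_ : N = setT `&` h @^-1` [set` `]-oo, 0[]); first exact: mh.
  by rewrite setTI; apply/seteqP; split => x; rewrite /N/= in_itv.
have -> : (\int[P]_(w in X @^-1` B) (atrisk T C t w)%:E = P (X @^-1` B `&` Y))%E.
  rewrite setIC -integral_indic//; last exact: mXB.
  apply: eq_integral => w _; rewrite indicE /atrisk le_min; congr (_%:E).
  by have [H|H] := boolP (_ && _); [rewrite mem_set//; exact/andP|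
     rewrite memNset// => /andP; exact/negP].
(* This probability is the integral of a negative function, so it is both nonnegative and
   nonpositive. *)
have PN : P (X @^-1` (B `&` N) `&` Y) = 0%E.
  apply/eqP; rewrite eq_le measure_ge0 andbT lawh; last exact: measurableI.
  rewrite integralE integral0_eq ?sub0e ?oppe_le0 ?integral_ge0//.
  by move=> w -[_ /ltW hw]; rewrite funeposE; apply/max_idPr; rewrite lee_fin.
have -> : X @^-1` B `&` Y =
    (X @^-1` (B `&` N) `&` Y) `|` (X @^-1` (B `\` N) `&` Y).
  by rewrite -setIUl -preimage_setU setUIDK.
transitivity (P (X @^-1` (B `&` N) `&` Y) + P (X @^-1` (B `\` N) `&` Y))%E.
  apply: measureU.
  - by apply: measurableI => //; apply: mXB; exact: measurableI.
  - by apply: measurableI => //; apply: mXB; exact: measurableD.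
  - by apply/seteqP; split => // w [[[_ Nw] _] [[_ nNw] _]].
rewrite PN add0e lawh; last exact: measurableD.
rewrite [in LHS]integral_mkcond [in RHS]integral_mkcond.
apply: eq_integral => w _; rewrite /patch.
have [BN|BN] := boolP (w \in X @^-1` (B `\` N)).
  move: BN; rewrite inE => -[Bw /negP]; rewrite -leNgt => h0.
  by rewrite mem_set// (max_idPr h0).
case: ifPn => //; rewrite inE => Bw; rewrite -/(h (X w)) (max_idPl _)//.
apply: ltW; apply: contrapT => Nw.
by move/negP: BN; apply; rewrite inE; split.
Qed.

(** * Covariates with conditional mean zero *)

(** Zero conditional mean says that the positive and negative parts of [Xc X j] have the same
    integral on every set of [sigmaX X S]. Comparing the parts, rather than integrating their
    difference, allows [phi] to be unbounded. *)
Lemma condexp_zero_comp (R : realType) (p : nat) (d : measure_display)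
    (Omega : measurableType d) (P : probability Omega R)
    (X : Omega -> p.-tuple R) (S : set 'I_p) (j : 'I_p)
    (phi : p.-tuple R -> \bar R) :
  measurable_fun setT X -> condexp_zero P (Xc X j) (sigmaX X S) ->
  measurable_fun setT phi -> (forall x, (0 <= phi x)%E) ->
  (forall x, phi (keep S x) = phi x) ->
  (\int[P]_w (phi (X w) * (Num.max (Xc X j w) 0)%:E) =
   \int[P]_w (phi (X w) * (Num.max (- Xc X j w) 0)%:E))%E.
Proof.
move=> mX [iX cX] mphi phi0 phiS.
have mXj : measurable_fun setT (Xc X j) by exact/measurable_EFinP/(measurable_int P).
have mk : measurable_fun setT (fun w => keep S (X w)).
  apply/measurable_fun_tnthP => i.
  rewrite (_ : _ \o _ = fun w => if `[< S i >] then Xc X i w else 0); last first.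
    by apply/funext => w; rewrite /= tnth_keep.
  case: asboolP => // _; exact: (measurableT_comp (measurable_tnth i) mX).
under eq_integral do rewrite -phiS.
under [RHS]eq_integral do rewrite -phiS.
apply: (integral_comp_eq _ _ _ _ _ _ (fun w => keep S (X w))) => //.
- exact: measurable_maxr.
- by apply: measurable_maxr => //; exact: measurable_funN.
- by move=> w; rewrite le_max lexx orbT.
- by move=> w; rewrite le_max lexx orbT.
move=> B mB.
have mA : measurable ((fun w => keep S (X w)) @^-1` B).
  by rewrite -[X in measurable X]setTI; exact: mk.
have : sigmaX X S ((fun w => keep S (X w)) @^-1` B).
  apply: sigmaX_preimage mB => i; have [Si|Si] := pselect (S i).
    by left; split=> // w; rewrite tnth_keep asboolT.
  by right; exists 0 => w; rewrite tnth_keep asboolF.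
move=> /cX; rewrite [LHS]integralE => XA.
have iA : P.-integrable ((fun w => keep S (X w)) @^-1` B) (fun w => (Xc X j w)%:E).
  exact: integrableS iX.
have -> : (\int[P]_(w in (fun w => keep S (X w)) @^-1` B) (Num.max (Xc X j w) 0)%:E =
    \int[P]_(w in (fun w => keep S (X w)) @^-1` B) (fun w => (Xc X j w)%:E)^\+ w)%E.
  by apply: eq_integral => w _; rewrite funeposE EFin_max.
have -> : (\int[P]_(w in (fun w => keep S (X w)) @^-1` B) (Num.max (- Xc X j w) 0)%:E =
    \int[P]_(w in (fun w => keep S (X w)) @^-1` B) (fun w => (Xc X j w)%:E)^\- w)%E.
  by apply: eq_integral => w _; rewrite funenegE EFin_max.
(* Both parts have finite integrals, so a zero difference forces equality. *)
move: (integrable_pos_fin_num mA iA) (integrable_neg_fin_num mA iA) XA.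
set a := integral _ _ _; set b := integral _ _ _.
by case: a b => [a| |] [b| |]//= _ _ [] /subr0_eq ->.
Qed.

(** Conditioning on [X] replaces the at-risk indicator times [g (X w)] by [k (X w)], where [k]
    depends only on the coordinates in [S]; the two parts of [Xc X j] then cancel. It serves both
    for [mu1] and for [mu1b]. *)
Lemma Rintegral_atrisk_condexp_zero (R : realType) (p : nat) (d : measure_display)
    (Omega : measurableType d) (P : probability Omega R)
    (X : Omega -> p.-tuple R) (T C : Omega -> R)
    (lam0 : R -> p.-tuple R -> R) (G : R -> p.-tuple R -> R) t
    (S : set 'I_p) (j : 'I_p) (g : p.-tuple R -> R) :
  measurable_fun setT X -> measurable_fun setT T -> measurable_fun setT C ->
  (forall s x, 0 <= lam0 s x) ->
  measurable_fun setT (fun z : R * p.-tuple R => lam0 z.1 z.2) ->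
  measurable_fun setT (G t) ->
  (forall A : set Omega, sigmaX X setT A ->
     P (A `&` [set w | t <= T w] `&` [set w | t <= C w]) =
     (\int[P]_(w in A) (survT lam0 t (X w) * (G t (X w))%:E))%E) ->
  Sinfl lam0 `|` Sinfl G `<=` S ->
  condexp_zero P (Xc X j) (sigmaX X S) ->
  measurable_fun setT g -> (forall x, 0 <= g x) ->
  (forall x, g (keep S x) = g x) ->
  Rintegral P setT (fun w => atrisk T C t w * Xc X j w * g (X w)) = 0.
Proof.
move=> mX mT mC l0 ml mG law lGS cX mg g0 gS.
pose k x := g x * Num.max 0 (fine (survT lam0 t x) * G t x).
have k0 x : 0 <= k x by rewrite mulr_ge0// le_max lexx.
have mk : measurable_fun setT k.
  apply: measurable_funM => //; apply: measurable_maxr => //.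
  by apply: measurable_funM => //; exact: measurable_survT.
have kS x : k (keep S x) = k x.
  have agree i : S i -> tnth (keep S x) i = tnth x i.
    by move=> Si; rewrite tnth_keep asboolT.
  rewrite /k gS; congr (_ * Num.max 0 (fine _ * _)).
    rewrite /survT; congr (expeR (- _)%E); apply: eq_integral => s _; congr (_%:E).
    by apply: Sinfl_eq agree => i li; apply: lGS; left.
  by apply: Sinfl_eq agree => i li; apply: lGS; right.
(* [f] will be the positive or the negative part of the covariate. *)
have part (f : R -> R) : measurable_fun setT f -> (forall x, 0 <= f x) ->
    (\int[P]_w (atrisk T C t w * f (Xc X j w) * g (X w))%:E =
     \int[P]_w ((k (X w))%:E * (f (Xc X j w))%:E))%E.
  move=> mf f0.
  have := integral_atrisk _ _ _ _ P X T C lam0 G t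
    (fun x => (g x * f (tnth x j))%:E) mX mT mC l0 ml mG law.
  have mgf : measurable_fun setT (fun x => (g x * f (tnth x j))%:E).
    apply/measurable_EFinP/measurable_funM => //.
    exact: (measurableT_comp mf (measurable_tnth j)).
  move=> /(_ mgf) => H; under eq_integral do
    rewrite -mulrA mulrC [_ * g _]mulrC EFinM.
  rewrite H; last by move=> x; rewrite lee_fin mulr_ge0.
  by apply: eq_integral => w _; rewrite -!EFinM /k mulrAC.
have mX0 : measurable_fun setT (fun x : R => Num.max x 0) by exact: measurable_maxr.
have mN0 : measurable_fun setT (fun x : R => Num.max (- x) 0).
  by apply: measurable_maxr => //; exact: measurable_funN.
rewrite /Rintegral integralE.
have -> : (\int[P]_w (fun w => (atrisk T C t w * Xc X j w * g (X w))%:E)^\+ w =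
  \int[P]_w (atrisk T C t w * Num.max (Xc X j w) 0 * g (X w))%:E)%E.
  apply: eq_integral => w _; rewrite funeposE -EFin_max.
  by rewrite -[X in Num.max _ X](mul0r (g (X w))) -maxr_pMl// maxr_pMr ?atrisk_ge0// mulr0.
have -> : (\int[P]_w (fun w => (atrisk T C t w * Xc X j w * g (X w))%:E)^\- w =
  \int[P]_w (atrisk T C t w * Num.max (- Xc X j w) 0 * g (X w))%:E)%E.
  apply: eq_integral => w _; rewrite funenegE -EFin_max -mulNr -mulrN.
  by rewrite -[X in Num.max _ X](mul0r (g (X w))) -maxr_pMl// maxr_pMr ?atrisk_ge0// mulr0.
rewrite (part (fun x => Num.max x 0))//; last by move=> x; rewrite le_max lexx orbT.
rewrite (part (fun x => Num.max (- x) 0))//; last by move=> x; rewrite le_max lexx orbT.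
rewrite (condexp_zero_comp _ _ _ _ _ _ S j (fun x => (k x)%:E))//.
(* The two integrals coincide; were they infinite, their difference would be infinite too, and
   [fine] sends it to 0. *)
- by case: (integral _ _ _) => //= r; rewrite subrr.
- exact/measurable_EFinP.
- by move=> x; rewrite kS.
Qed.

(** * Real-valued integrals, Jensen's inequality for the exponential, and elementary bounds *)

Lemma integrable_EFinZl (d : measure_display) (T : measurableType d)
    (R : realType) (mu : {measure set T -> \bar R}) (D : set T) (k : R) (f : T -> R) :
  measurable D -> mu.-integrable D (fun x => (f x)%:E) ->
  mu.-integrable D (fun x => (k * f x)%:E).
Proof. by move=> mD /(integrableZl mD k); under eq_fun do rewrite -EFinM. Qed.

Lemma integrable_EFinB (d : measure_display) (T : measurableType d)
    (R : realType) (mu : {measure set T -> \bar R}) (D : set T) (f g : T -> R) :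
  measurable D -> mu.-integrable D (fun x => (f x)%:E) ->
  mu.-integrable D (fun x => (g x)%:E) ->
  mu.-integrable D (fun x => (f x - g x)%:E).
Proof. by move=> mD intf intg; exact: (integrableB mD intf intg). Qed.

Lemma integrable_EFin_sum (d : measure_display) (T : measurableType d)
    (R : realType) (mu : {measure set T -> \bar R}) (D : set T) (n : nat)
    (f : 'I_n -> T -> R) :
  measurable D -> (forall j, mu.-integrable D (fun x => (f j x)%:E)) ->
  mu.-integrable D (fun x => (\sum_j f j x)%:E).
Proof.
move=> mD intf; under eq_fun do rewrite -sumEFin.
by apply: integrable_sum => // j _; exact: intf.
Qed.

Lemma Rintegral_sum (d : measure_display) (T : measurableType d)
    (R : realType) (mu : {measure set T -> \bar R}) (D : set T) (n : nat)
    (f : 'I_n -> T -> R) :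
  measurable D -> (forall j, mu.-integrable D (fun x => (f j x)%:E)) ->
  Rintegral mu D (fun x => \sum_j f j x) = \sum_j Rintegral mu D (f j).
Proof.
move=> mD intf; rewrite /Rintegral.
under eq_integral do rewrite -sumEFin.
rewrite integral_sum// -sum_fine// => j _; exact: integrable_fin_num.
Qed.

Lemma ge0_Rintegral_eq0 (d : measure_display) (T : measurableType d)
    (R : realType) (mu : {measure set T -> \bar R}) (D : set T) (f : T -> R) :
  measurable D -> mu.-integrable D (EFin \o f) -> (forall x, D x -> 0 <= f x) ->
  Rintegral mu D f <= 0 -> {ae mu, forall x, D x -> f x = 0}.
Proof.
move=> mD intf f0 le0.
have int0 : (\int[mu]_(x in D) `|(EFin \o f) x| = 0)%E.
  transitivity (\int[mu]_(x in D) (f x)%:E)%E.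
    by apply: eq_integral => x; rewrite inE => Dx; rewrite gee0_abs//= lee_fin f0.
  rewrite -[LHS]fineK; last exact: (integrable_fin_num mD intf).
  by congr (_%:E); apply/eqP; rewrite eq_le le0; exact: Rintegral_ge0.
have := (ae_eq_integral_abs mu mD (measurable_int mu intf)).1 int0.
by apply: filterS => x H Dx; have [] := H Dx.
Qed.

(* [expR U >= expR m * (1 + (U - m))], with equality only at [U = m]. *)
Lemma Jensen_expR (d : measure_display) (T : measurableType d) (R : realType)
    (mu : {measure set T -> \bar R}) (w U : T -> R)
    (m := Rintegral mu setT (fun x => w x * U x) / Rintegral mu setT w) :
  (forall x, 0 <= w x) ->
  mu.-integrable setT (EFin \o w) ->
  mu.-integrable setT (fun x => (w x * U x)%:E) ->
  mu.-integrable setT (fun x => (w x * expR (U x))%:E) ->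
  0 < Rintegral mu setT w ->
  expR m * Rintegral mu setT w <= Rintegral mu setT (fun x => w x * expR (U x)) /\
  (Rintegral mu setT (fun x => w x * expR (U x)) = expR m * Rintegral mu setT w ->
   {ae mu, forall x, w x * expR (U x) = expR m * w x}).
Proof.
move=> w0 iw iwU iwe M0.
(* Weighted gap between the exponential and its tangent at [m]. As [m] is the weighted mean of [U],
   the linear term of the tangent integrates to zero. *)
pose k x := w x * expR (U x) - (expR m * (1 - m) * w x + expR m * (w x * U x)).
have kE x : k x = w x * expR m * (expR (U x - m) - (1 + (U x - m))).
  rewrite /k expRD expRN; field; exact/lt0r_neq0/expR_gt0.
have k0 x : 0 <= k x.
  by rewrite kE !mulr_ge0 ?expR_ge0// subr_ge0 expR_ge1Dx.
have i1 : mu.-integrable setT (fun x => (expR m * (1 - m) * w x)%:E) by exact: integrable_EFinZl.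
have i2 : mu.-integrable setT (fun x => (expR m * (w x * U x))%:E).
  exact: integrable_EFinZl.
have i12 : mu.-integrable setT
    (fun x => (expR m * (1 - m) * w x + expR m * (w x * U x))%:E).
  exact: (integrableD measurableT i1 i2).
have ik : mu.-integrable setT (EFin \o k) by exact: (integrableB measurableT iwe i12).
have intk : Rintegral mu setT k =
    Rintegral mu setT (fun x => w x * expR (U x)) - expR m * Rintegral mu setT w.
  rewrite RintegralB// RintegralD// !RintegralZl//; congr (_ - _).
  by rewrite /m; field; exact: lt0r_neq0.
split; first by rewrite -subr_ge0 -intk; apply: Rintegral_ge0 => x _; exact: k0.
(* Equality makes the nonnegative gap vanish almost everywhere; strict convexity then leaves only
   [w x = 0] or [U x = m]. *)
move=> Meq; have : {ae mu, forall x, setT x -> k x = 0}.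
  by apply: ge0_Rintegral_eq0 => //; rewrite intk Meq subrr.
apply: filterS => x /(_ I) /eqP; rewrite kE !mulf_eq0 [expR m == 0]gt_eqF ?expR_gt0// orbF.
case/orP => [/eqP ->|]; first by rewrite mul0r mulr0.
have [->|Um] := eqVneq (U x) m; first by rewrite mulrC.
by rewrite subr_eq0 gt_eqF// expR_gt1Dx// subr_eq0.
Qed.

Lemma ln_tilt_ge0 (R : realType) (a b m : R) : 0 < a -> 0 < b ->
  expR m * a <= b -> 0 <= ln b - ln a - m.
Proof.
move=> a0 b0 ab; rewrite -addrA -opprD subr_ge0 addrC -ler_expR expRD.
by rewrite !lnK ?posrE.
Qed.

Lemma ln_tilt_eq0 (R : realType) (a b m : R) : 0 < a -> 0 < b ->
  ln b - ln a - m = 0 -> b = expR m * a.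
Proof.
move=> a0 b0 ab; rewrite -{1}(lnK (x := b)) ?posrE// -{1}(lnK (x := a)) ?posrE//.
by rewrite -expRD; congr expR; lra.
Qed.

(** A linear factor is absorbed by shifting the exponent both ways; this dominates the integrand of
    [mu1b]. *)
Lemma normr_mul_expR_le (R : realType) (x y : R) :
  `|x| * expR y <= expR (y + x) + expR (y - x).
Proof.
rewrite !expRD -mulrDr mulrC ler_wpM2l ?expR_ge0//.
have H (z : R) : z <= expR z by rewrite (le_trans _ (expR_ge1Dx z))// lerDr.
have [x0|/ltW x0] := leP 0 x.
  by rewrite ger0_norm// (le_trans (H x))// lerDl expR_ge0.
by rewrite ler0_norm// (le_trans (H (- x)))// lerDr expR_ge0.
Qed.

(** * The at-risk law tilted by the exponential of a linear predictor *)

Section tilting.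
Context {R : realType} {p : nat} {d : measure_display} {Omega : measurableType d}.
Context {P : probability Omega R} {X : Omega -> p.-tuple R} {T C : Omega -> R}.
Context (mX : measurable_fun setT X) (mT : measurable_fun setT T)
  (mC : measurable_fun setT C).
Context (i0b : forall b t,
  P.-integrable setT (fun w => (atrisk T C t w * expR (lin X b w))%:E)).

Let mXc j : measurable_fun setT (Xc X j).
Proof. exact: (measurableT_comp (measurable_tnth j) mX). Qed.

Let mlin b : measurable_fun setT (lin X b).
Proof. by apply: measurable_sum => j; exact: measurable_funM. Qed.

Lemma linD (b v : 'rV[R]_p) w : lin X (b + v) w = lin X b w + lin X v w.
Proof. by rewrite /lin -big_split; apply: eq_bigr => j _; rewrite mxE mulrDr. Qed.

Lemma linN (b : 'rV[R]_p) w : lin X (- b) w = - lin X b w.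
Proof. by rewrite /lin -sumrN; apply: eq_bigr => j _; rewrite mxE mulrN. Qed.

Lemma lin_delta j w : lin X (delta_mx 0 j) w = Xc X j w.
Proof.
rewrite /lin (bigD1 j)//= mxE !eqxx mulr1 big1 ?addr0// => i /negbTE ij.
by rewrite mxE eqxx ij mulr0.
Qed.

(** Dominated by the [mu0b] integrands at [b] shifted by plus and minus the [j]-th unit vector. *)
Lemma integrable_mu1b b t j : P.-integrable setT
  (fun w => (atrisk T C t w * Xc X j w * expR (lin X b w))%:E).
Proof.
apply: (le_integrable measurableT _ _
  (integrableD measurableT (i0b (b + delta_mx 0 j) t) (i0b (b - delta_mx 0 j) t))).
  apply/measurable_EFinP; apply: measurable_funM; last exact: measurableT_comp.
  by apply: measurable_funM => //; exact: measurable_atrisk.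
move=> w _; rewrite /= lee_fin -mulrDr !linD linN lin_delta -mulrA 2!normrM.
have a0 := atrisk_ge0 _ _ _ T C t w.
rewrite [leRHS]ger0_norm ?mulr_ge0// ?addr_ge0 ?expR_ge0//.
rewrite (ger0_norm a0) (ger0_norm (expR_ge0 _)) ler_wpM2l//.
exact: normr_mul_expR_le.
Qed.

Lemma mu0b_ge0 b t : 0 <= mu0b P X T C b t.
Proof. by apply: Rintegral_ge0 => w _; rewrite mulr_ge0 ?atrisk_ge0 ?expR_ge0. Qed.

(** The exponential is positive, so [mu0b] vanishes only if almost nobody is at risk. Hence a zero
    denominator in the ratios always comes with the weight [mu0] equal to 0. *)
Lemma mu0b_eq0 lam0 b t : mu0b P X T C b t = 0 ->
  P.-integrable setT (fun w => (atrisk T C t w * lam0 t (X w))%:E) ->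
  mu0 P X T C lam0 t = 0.
Proof.
move=> M0 il.
have : {ae P, forall w, setT w -> atrisk T C t w * expR (lin X b w) = 0}.
  apply: ge0_Rintegral_eq0 => //.
  - exact: i0b.
  - by move=> w _; rewrite mulr_ge0 ?atrisk_ge0 ?expR_ge0.
  - by rewrite -/(mu0b P X T C b t) M0.
move=> ae0; rewrite /mu0 /Rintegral (ae_eq_integral (cst 0%E))//.
- by rewrite integral0.
- exact: measurable_int il.
- apply: filterS ae0 => w /(_ I)/eqP; rewrite mulf_eq0 [expR _ == _]gt_eqF ?expR_gt0// orbF.
  by move=> /eqP -> _; rewrite mul0r.
Qed.

(** Jensen's inequality with weight 1(Y >= t) exp(X b) and exponent X (b' - b), whose weighted mean
    is [m]. In the equality case the integrands at [b'] and [b] differ almost surely by the factor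
    [expR m], which multiplication by a covariate preserves. *)
Lemma mu0b_tilt (b b' : 'rV[R]_p) (t : R)
    (m := \sum_j (b' - b) 0 j * (mu1b P X T C b t j / mu0b P X T C b t)) :
  0 < mu0b P X T C b t ->
  expR m * mu0b P X T C b t <= mu0b P X T C b' t /\
  (mu0b P X T C b' t = expR m * mu0b P X T C b t ->
   forall j, mu1b P X T C b' t j = expR m * mu1b P X T C b t j).
Proof.
move=> M0.
pose a w := atrisk T C t w * expR (lin X b w).
pose U := lin X (b' - b).
have aUE w : a w * U w =
    \sum_j (b' - b) 0 j * (atrisk T C t w * Xc X j w * expR (lin X b w)).
  rewrite /U /lin mulr_sumr; apply: eq_bigr => j _; rewrite /a /lin; ring.
have aeE w : a w * expR (U w) = atrisk T C t w * expR (lin X b' w).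
  by rewrite /a /U -mulrA -expRD -linD addrC subrK.
have iterm j : P.-integrable setT (fun w =>
    ((b' - b) 0 j * (atrisk T C t w * Xc X j w * expR (lin X b w)))%:E).
  by apply: integrable_EFinZl => //; exact: integrable_mu1b.
have iaU : P.-integrable setT (fun w => (a w * U w)%:E).
  by under eq_fun do rewrite aUE; exact: integrable_EFin_sum.
have iae : P.-integrable setT (fun w => (a w * expR (U w))%:E).
  by under eq_fun do rewrite aeE; exact: i0b.
have mE : Rintegral P setT (fun w => a w * U w) / Rintegral P setT a = m.
  rewrite (@eq_Rintegral _ _ _ P setT (fun w => \sum_j (b' - b) 0 j *
    (atrisk T C t w * Xc X j w * expR (lin X b w)))); last by move=> w _; exact: aUE.
  rewrite Rintegral_sum// mulr_suml; apply: eq_bigr => j _.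
  by rewrite RintegralZl// ?mulrA//; exact: integrable_mu1b.
have [] := Jensen_expR _ _ _ P a U _ (i0b b t) iaU iae M0.
  by move=> w; rewrite mulr_ge0 ?atrisk_ge0 ?expR_ge0.
rewrite mE -/(mu0b P X T C b t).
have -> : Rintegral P setT (fun w => a w * expR (U w)) = mu0b P X T C b' t.
  by apply: eq_Rintegral => w _; exact: aeE.
move=> ineq aeq; split=> // /aeq {}aeq j.
rewrite /mu1b -RintegralZl//; last exact: integrable_mu1b.
congr fine; apply: ae_eq_integral => //.
- exact: (measurable_int P (integrable_mu1b b' t j)).
- exact: (measurable_int P (integrable_EFinZl _ _ _ _ _ _ _ measurableT (integrable_mu1b b t j))).
- apply: filterS aeq => w; rewrite aeE => H _; congr (_%:E).
  by rewrite mulrAC H /a; ring.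
Qed.
End tilting.

(** * Comparison of the pseudo-true parameter with its restriction to [S] *)

Lemma pseudo_true_support (R : realType) (p : nat) (d : measure_display)
    (Omega : measurableType d) (P : probability Omega R)
    (X : Omega -> p.-tuple R) (T C : Omega -> R)
    (lam0 : R -> p.-tuple R -> R) (G : R -> p.-tuple R -> R) (b0 : 'rV[R]_p)
    (S := Sinfl lam0 `|` Sinfl G) :
  measurable_fun setT X -> measurable_fun setT T -> measurable_fun setT C ->
  (forall t x, 0 <= lam0 t x) ->
  measurable_fun setT (fun z : R * p.-tuple R => lam0 z.1 z.2) ->
  (forall u, measurable_fun setT (G u)) ->
  (forall (t : R) (A : set Omega), sigmaX X setT A ->
     P (A `&` [set w | t <= T w] `&` [set w | t <= C w]) =
     (\int[P]_(w in A) (survT lam0 t (X w) * (G t (X w))%:E))%E) ->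
  (forall b t, P.-integrable setT (fun w => (atrisk T C t w * expR (lin X b w))%:E)) ->
  (forall t, P.-integrable setT (fun w => (atrisk T C t w * lam0 t (X w))%:E)) ->
  (forall b, leb.-integrable [set t : R | 0 <= t]
     (fun t => (ln (mu0b P X T C b t) * mu0 P X T C lam0 t)%:E)) ->
  (forall b j, leb.-integrable [set t : R | 0 <= t]
     (fun t => (mu1b P X T C b t j / mu0b P X T C b t * mu0 P X T C lam0 t)%:E)) ->
  (forall j, estim P X T C lam0 b0 j = 0) ->
  (forall b, (forall j, estim P X T C lam0 b j = 0) -> b = b0) ->
  (forall j, ~ S j -> condexp_zero P (Xc X j) (sigmaX X S)) ->
  [set j | b0 0 j != 0] `<=` S.
Proof.
move=> mX mT mC l0 ml mG law i0b i0 iln ir b0sol b0uniq cX.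
pose M b t := mu0b P X T C b t.
pose L t := mu0 P X T C lam0 t.
pose r b j t := mu1b P X T C b t j / M b t * L t.
pose b : 'rV[R]_p := \row_j (if `[< S j >] then b0 0 j else 0).
suff bsol : forall j, estim P X T C lam0 b j = 0.
  move=> j /eqP b0j; apply: contrapT => Sj; apply: b0j.
  by rewrite -(b0uniq _ bsol) mxE asboolF.
have bS j : S j -> b 0 j = b0 0 j by move=> Sj; rewrite mxE asboolT.
have bnS j : ~ S j -> b 0 j = 0 by move=> Sj; rewrite mxE asboolF.
have ml0 t : measurable_fun setT (lam0 t).
  have mt : measurable_fun setT (fun x : p.-tuple R => (t, x)) by exact: measurable_fun_pair.
  exact: (measurableT_comp ml mt).
have agree i x : S i -> tnth (keep S x) i = tnth x i.
  by move=> Si; rewrite tnth_keep asboolT.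
have mu1_0 t j : ~ S j -> mu1 P X T C lam0 t j = 0.
  move=> Sj; apply: (Rintegral_atrisk_condexp_zero _ _ _ _ _ _ _ _ lam0 G t S j (lam0 t)) => //.
  - exact: law.
  - exact: cX.
  - move=> x; apply: (Sinfl_eq _ _ _ S) => [i|i Si]; [by left|exact: agree].
have mu1b_0 t j : ~ S j -> mu1b P X T C b t j = 0.
  move=> Sj; pose g (x : p.-tuple R) := expR (\sum_(i < p) tnth x i * b 0 i).
  apply: (Rintegral_atrisk_condexp_zero _ _ _ _ _ _ _ _ lam0 G t S j g) => //.
  - exact: law.
  - exact: cX.
  - apply: measurableT_comp => //; apply: measurable_sum => i.
    by apply: measurable_funM => //; exact: measurable_tnth.
  - by move=> x; exact: expR_ge0.
  - move=> x; congr expR; apply: eq_bigr => i _.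
    by have [Si|Si] := pselect (S i); [rewrite agree|rewrite bnS// !mulr0].
have L0 t : 0 <= L t.
  by apply: Rintegral_ge0 => w _; rewrite mulr_ge0 ?atrisk_ge0.
have Mpos t b' : L t != 0 -> 0 < M b' t.
  move=> Lt; rewrite lt_neqAle mu0b_ge0 andbT eq_sym.
  by apply: contra_neq Lt => /(mu0b_eq0 i0b lam0); apply.
(* Tilting at [b], the exponent X (b0 - b) has mean zero: its coefficients vanish on [S], and [mu1b]
   at [b] vanishes outside [S]. *)
have M_le t : L t != 0 -> M b t <= M b0 t.
  move=> Lt; have [+ _] := mu0b_tilt mX mT mC i0b b b0 t (Mpos t b Lt).
  rewrite big1 ?expR0 ?mul1r// => j _.
  have [Sj|Sj] := pselect (S j).
    by rewrite !mxE asboolT// subrr mul0r.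
  by rewrite mu1b_0// mul0r mulr0.
pose D t := ln (M b t) * L t - ln (M b0 t) * L t.
(* Jensen gap from [b0] to [b], weighted by [L]. By the estimating equations at [b0], its integral
   is l(b0) - l(b). *)
pose g t := D t - \sum_j (b - b0) 0 j * r b0 j t.
pose m t := \sum_j (b - b0) 0 j * (mu1b P X T C b0 t j / M b0 t).
have gE t : g t = (ln (M b t) - ln (M b0 t) - m t) * L t.
  rewrite /g /D 2!mulrBl; congr (_ - _).
  by rewrite /m mulr_suml; apply: eq_bigr => j _; rewrite -[RHS]mulrA.
have Jensen t : L t != 0 -> expR (m t) * M b0 t <= M b t /\
    (M b t = expR (m t) * M b0 t ->
     forall j, mu1b P X T C b t j = expR (m t) * mu1b P X T C b0 t j).
  by move=> Lt; exact: (mu0b_tilt mX mT mC i0b b0 b t (Mpos t b0 Lt)).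
have g0 t : 0 <= g t.
  rewrite gE; have [->|Lt] := eqVneq (L t) 0; first by rewrite mulr0.
  have [ineq _] := Jensen t Lt.
  have := Mpos t b Lt; have := Mpos t b0 Lt => M0 M1.
  by apply: mulr_ge0 => //; exact: ln_tilt_ge0.
have r_eq t : g t = 0 -> forall j, r b j t = r b0 j t.
  have [Lt _ j|Lt gt j] := eqVneq (L t) 0; first by rewrite /r Lt [LHS]mulr0 [RHS]mulr0.
  have M0 := Mpos t b0 Lt; have M1 := Mpos t b Lt.
  have [_ eqM] := Jensen t Lt.
  move/eqP: gt; rewrite gE mulf_eq0 (negbTE Lt) orbF => /eqP.
  move=> /(ln_tilt_eq0 _ _ _ _ M0 M1) ME.
  (* The common factor [expR (m t)] cancels in the ratio. *)
  rewrite /r (eqM ME) ME invfM mulrACA mulfV ?mul1r//.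
  by rewrite gt_eqF// expR_gt0.
have m0 : measurable [set t : R | 0 <= t].
  rewrite (_ : [set t | _] = [set` `[0, +oo[]) //.
  by apply/seteqP; split => t /=; rewrite in_itv/= andbT.
have iD : leb.-integrable [set t : R | 0 <= t] (fun t => (D t)%:E).
  by apply: integrable_EFinB => //; exact: iln.
have irj j : leb.-integrable [set t : R | 0 <= t]
    (fun t => ((b - b0) 0 j * r b0 j t)%:E).
  by apply: integrable_EFinZl => //; exact: ir.
have isum : leb.-integrable [set t : R | 0 <= t]
    (fun t => (\sum_j (b - b0) 0 j * r b0 j t)%:E).
  exact: integrable_EFin_sum.
have ig : leb.-integrable [set t : R | 0 <= t] (EFin \o g).
  exact: integrable_EFinB.
(* Each linear term integrates to 0: on [S] its coefficient vanishes, and outside [S] the estimating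
   equation equates the integral of [r b0 j] with that of [mu1], which is zero. What remains is [D],
   nonpositive by [M_le]. *)
have int_le0 : Rintegral leb [set t : R | 0 <= t] g <= 0.
  rewrite RintegralB// Rintegral_sum// big1 ?subr0.
    rewrite -oppr_ge0 -mulN1r -RintegralZl//.
    apply: Rintegral_ge0 => t _.
    rewrite mulN1r oppr_ge0 /D -mulrBl.
    have [->|Lt] := eqVneq (L t) 0; first by rewrite mulr0.
    by rewrite mulr_le0_ge0// subr_le0 ler_ln ?posrE ?Mpos// M_le.
  move=> j _; rewrite RintegralZl//; last exact: ir.
  have [Sj|Sj] := pselect (S j); first by rewrite !mxE asboolT// subrr mul0r.
  have -> : Rintegral leb [set t : R | 0 <= t] (r b0 j) =
      Rint0oo (fun t => mu1 P X T C lam0 t j) by exact/esym/subr0_eq/b0sol.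
  rewrite /Rint0oo (@eq_Rintegral _ _ _ leb _ (cst 0)).
    by rewrite Rintegral_cst// mul0r mulr0.
  by move=> t _; rewrite mu1_0.
have g_ae := ge0_Rintegral_eq0 _ _ _ leb _ g m0 ig (fun t _ => g0 t) int_le0.
have rE j : Rint0oo (r b j) = Rint0oo (r b0 j).
  apply: (congr1 fine); apply: ae_eq_integral => //.
  - exact: (measurable_int leb (ir b j)).
  - exact: (measurable_int leb (ir b0 j)).
  - by apply: filterS g_ae => t H t0; congr (_%:E); exact: r_eq (H t0) j.
move=> j; have := b0sol j; rewrite /estim.
by have := rE j; rewrite /r /M /L => ->.
Qed.

Theorem theorem1 (R : realType) (p : nat) (d : measure_display)
  (Omega : measurableType d) (P : probability Omega R)
  (X : Omega -> p.-tuple R) (T C : Omega -> R)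
  (lam0 : R -> p.-tuple R -> R) (G : R -> p.-tuple R -> R) (b0 : 'rV[R]_p) :
  (* random variables *)
  measurable_fun setT X -> measurable_fun setT T -> measurable_fun setT C ->
  (* lam0 is a (jointly measurable, nonnegative) hazard, G (u, x) is measurable in x *)
  (forall t x, 0 <= lam0 t x) ->
  measurable_fun setT (fun z : R * p.-tuple R => lam0 z.1 z.2) ->
  (forall u, measurable_fun setT (G u)) ->
  (* lam0(t|X) is the true conditional hazard of T given X, G(u|X) = P(C >= u | X),
     and T, C are conditionally independent given X *)
  (forall (t u : R) (A : set Omega), sigmaX X setT A ->
     P (A `&` [set w | t <= T w] `&` [set w | u <= C w]) =
     (\int[P]_(w in A) (survT lam0 t (X w) * (G u (X w))%:E))%E) ->
  (* regularity: all expectations and integrals involved exist and are finite *)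
  (forall b t, P.-integrable setT (fun w => (atrisk T C t w * expR (lin X b w))%:E)) ->
  (forall t, P.-integrable setT (fun w => (atrisk T C t w * lam0 t (X w))%:E)) ->
  (forall t j, P.-integrable setT (fun w => (atrisk T C t w * Xc X j w * lam0 t (X w))%:E)) ->
  (forall j, leb.-integrable [set t : R | 0 <= t] (fun t => (mu1 P X T C lam0 t j)%:E)) ->
  (forall b, leb.-integrable [set t : R | 0 <= t]
     (fun t => (ln (mu0b P X T C b t) * mu0 P X T C lam0 t)%:E)) ->
  (forall b j, leb.-integrable [set t : R | 0 <= t]
     (fun t => (mu1b P X T C b t j / mu0b P X T C b t * mu0 P X T C lam0 t)%:E)) ->
  (* b0 is the unique solution of the estimating equations *)
  (forall j, estim P X T C lam0 b0 j = 0) ->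
  (forall b, (forall j, estim P X T C lam0 b j = 0) -> b = b0) ->
  posdef (Sigma P X T C lam0 b0) ->
  (* E(X2star | X1star) = 0, where X1star is indexed by S_lambda0 U S_C0 *)
  (forall j, ~ (Sinfl lam0 `|` Sinfl G) j ->
     condexp_zero P (Xc X j) (sigmaX X (Sinfl lam0 `|` Sinfl G))) ->
  [set j | b0 0 j != 0] `<=` Sinfl lam0 `|` Sinfl G /\
  ((* C independent of X: its conditional law given X does not depend on X *)
   (forall u x y, G u x = G u y) ->
   [set j | b0 0 j != 0] `<=` Sinfl lam0).
Proof.
move=> mX mT mC l0 ml mG law i0b i0 _ _ iln ir b0sol b0uniq _ cX.
have main : [set j | b0 0 j != 0] `<=` Sinfl lam0 `|` Sinfl G.
  (* {Y >= t} is the intersection of {T >= t} and {C >= t}, so the joint law is taken at [u = t]. *)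
  by apply: (pseudo_true_support _ _ _ _ P X T C) => // t A; exact: law.
(* A [G] constant in the covariates has no influential coordinate. *)
split=> // Gcst j /main [//|[t [x [y [_]]]]].
by rewrite (Gcst t x y) eqxx.
Qed.
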